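(* For almost all $(\alpha,\beta)\in\mathbb{C}^2$ (with respect to the 4-dimensional Lebesgue measure) with $|\alpha|>1$ and $|\beta|>1$ we have $$T_{\alpha,\beta}(x)=\frac{(\log x)^2}{\log|\alpha|\,\log|\beta|}+O(\log x\cdot\log\log x)$$ for $x$ large enough, where $T_{\alpha,\beta}(x)=\#\{(n,m)\in\mathbb{N}^2 : |\alpha^n-\beta^m|\leq x\}$.
   Context: $\mathbb{N}$ denotes the positive integers. $\mathbb{C}^2$ is identified with $\mathbb{R}^4$ with Lebesgue measure. The $O$-constant refers to $x\to\infty$ and may depend on $\alpha,\beta$. *)

(* Defs.v *)
From HB Require Import structures.
From mathcomp Require Import all_boot all_order all_algebra.
From mathcomp Require Import finmap.
From mathcomp Require Import all_classical all_reals all_analysis.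
From mathcomp Require Import complex.
Set Implicit Arguments.
Unset Strict Implicit.
Unset Printing Implicit Defensive.
Import Order.TTheory GRing.Theory Num.Theory.
Import numFieldNormedType.Exports.
Local Open Scope classical_set_scope.
Local Open Scope complex_scope.
Local Open Scope ring_scope.

(* The norm [`|z|] on [R[i]] takes values in [R[i]]; this is the real-valued
   modulus. *)
Definition modulus (R : realType) (z : R[i]) : R := ComplexField.Normc.normc z.

Definition toC (R : realType) (p : R * R) : R[i] := p.1 +i* p.2.

(* Lebesgue measure on C = R^2, in the coordinates (Re z, Im z). Its
   sigma-finiteness is declared by hand, because the library's instance for
   products of sigma-finite measures is not found by unification. *)
Definition lebesgueC (R : realType) :=
  (@lebesgue_measure R \x @lebesgue_measure R)%E.
Arguments lebesgueC R : clear implicits.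

HB.instance Definition _ (R : realType) := Measure.on (lebesgueC R).

Lemma lebesgueC_sigma_finite (R : realType) :
  sigma_finite setT (lebesgueC R).
Proof.
have /sigma_finiteP[F [TF ndF Foo]] := sigma_finiteT (@lebesgue_measure R).
exists (fun n => F n `*` F n).
  rewrite -setXTT TF predeqE => -[x y]; split.
    move=> [/= [n _ Fnx] [k _ Fky]]; exists (maxn n k) => //; split.
    - by move: x Fnx; exact/subsetPset/ndF/leq_maxl.
    - by move: y Fky; exact/subsetPset/ndF/leq_maxr.
  by move=> [n _ []/= ? ?]; split; exists n.
move=> k; have [mFk Fkoo] := Foo k.
split; first exact: measurableX.
by rewrite /lebesgueC product_measure1E// lte_mul_pinfty// ge0_fin_numE.
Qed.

HB.instance Definition _ (R : realType) :=
  Measure_isSigmaFinite.Build _ _ _ (lebesgueC R) (@lebesgueC_sigma_finite R).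

(* Lebesgue measure on C^2 = R^4. It lives on the Borel sets of R^4, but
   "almost everywhere" only asks the exceptional set to be contained in a
   measurable null set, so it agrees with the notion for the completed
   measure. *)
Definition lebesgueC2 (R : realType) := (lebesgueC R \x lebesgueC R)%E.
Arguments lebesgueC2 R : clear implicits.

HB.instance Definition _ (R : realType) := Measure.on (lebesgueC2 R).

Definition Tset (R : realType) (alpha beta : R[i]) (x : R) : set (nat * nat) :=
  [set nm | [/\ (0 < nm.1)%N, (0 < nm.2)%N &
             modulus (alpha ^+ nm.1 - beta ^+ nm.2) <= x]].

(* This is the number of elements of [Tset alpha beta x] only when that set is
   finite; on an infinite set it is 0. *)
Definition Tcard (R : realType) (alpha beta : R[i]) (x : R) : nat :=
  #|` fset_set (Tset alpha beta x)|.

(* The Landau notation is keyed on [filter_on], for which the library does not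
   register the filter at +oo. *)
Canonical pinfty_filter_on (R : realType) : filter_on R :=
  FilterType (pinfty_nbhs R) _.

(* Main.v *)
(** Write a = |alpha|, b = |beta|. Since ||alpha^n| - |beta^m|| bounds
    |alpha^n - beta^m| from below, only the moduli matter. Fix alpha and
    Re beta: if b <= K, the condition |a^n - b^m| (n+m)^6 <= b^m confines
    (Im beta)^2 to an interval of length O(K^2 / (n+m)^6), hence Im beta to a
    set of measure O(K / (n+m)^3). Summing over the pairs with n + m fixed
    gives a convergent series, so by Borel-Cantelli and Fubini, for almost all
    (alpha, beta), a^n and b^m are at most |alpha^n - beta^m| (1 + (n+m)^6) for
    all but finitely many (n, m). For such a pair |alpha^n - beta^m| <= x forces
    n + m = O(log x), and then n log a, m log b <= log x + 14 log log x.
    Conversely a^n, b^m <= x/2 suffices for |alpha^n - beta^m| <= x. The count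
    thus lies between those of two boxes, up to a constant. *)

Require Import Defs.
From mathcomp Require Import all_boot all_order all_algebra.
From mathcomp Require Import finmap.
From mathcomp Require Import all_classical all_reals all_analysis.
From mathcomp Require Import complex.
From mathcomp Require Import ring lra zify.
Import Order.TTheory GRing.Theory Num.Theory.
Import numFieldNormedType.Exports.
Local Open Scope classical_set_scope.
Local Open Scope ring_scope.
Set Implicit Arguments.
Unset Strict Implicit.
Unset Printing Implicit Defensive.

(** * Borel-Cantelli and real estimates for near coincidences *)

(** The majorants telescope: their partial sums are [C * (1 - N.+1%:R^-1)], at most [C], so the
    measures are summable. *)
Lemma borel_cantelli_telescope d (T : measurableType d) (R : realType)
    (mu : {measure set T -> \bar R}) (F : (set T)^nat) (C : R) : 0 <= C ->
  (forall k, measurable (F k)) ->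
  (forall k, (mu (F k) <= (C * (k.+1%:R^-1 - k.+2%:R^-1))%:E)%E) ->
  mu (lim_sup_set F) = 0%E.
Proof.
move=> C0 mF muF; apply: lim_sup_set_cvg0 => //.
apply: (@le_lt_trans _ _ C%:E); last exact: ltry.
apply: lime_le; first exact: is_cvg_nneseries.
apply: nearW => N.
apply: (@le_trans _ _ (\sum_(0 <= k < N) (C * (k.+1%:R^-1 - k.+2%:R^-1))%:E)%E).
  exact: lee_sum.
rewrite sumEFin lee_fin -mulr_sumr.
have -> : \sum_(0 <= k < N) (k.+1%:R^-1 - k.+2%:R^-1) = 1 - N.+1%:R^-1 :> R.
  elim: N => [|N IH]; first by rewrite big_geq// invr1 subrr.
  by rewrite big_nat_recr//= IH addrA subrK.
by rewrite ler_piMr// lerBlDr lerDl.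
Qed.

(** Fix one [y] in [S]. Applying the hypothesis in both orders puts every [|z|] within [h] of [|y|],
    so [S] lies in two intervals of length [2 * h], centred at [|y|] and [-|y|]. *)
Lemma lebesgue_measure_abs_clustered (R : realType) (S : set R) (h : R) :
  0 <= h -> measurable S ->
  (forall y z, S y -> S z -> `|z| <= `|y| + h) ->
  (lebesgue_measure S <= (4 * h)%:E)%E.
Proof.
move=> h0 mS Sh.
have [->|/set0P[y Sy]] := eqVneq S set0.
  by rewrite measure0 lee_fin mulr_ge0.
pose I1 := `[`|y| - h, `|y| + h]%classic; pose I2 := `[- `|y| - h, - `|y| + h]%classic.
have SI : S `<=` I1 `|` I2.
  move=> z Sz; have := Sh _ _ Sy Sz; have := Sh _ _ Sz Sy.
  rewrite /I1 /I2 /= !in_itv/=.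
  by have [z0|z0] := ger0P z => h1 h2; [left|right]; apply/andP; split; lra.
have mI (c : R) : lebesgue_measure `[c - h, c + h]%classic = (2 * h)%:E.
  rewrite lebesgue_measure_itv/= lte_fin.
  case: ifPn => [_|]; first by rewrite -EFinB; congr (_%:E); ring.
  by rewrite -leNgt => hh; congr (_%:E); lra.
have mI12 : measurable I1 /\ measurable I2 by split; exact: measurable_itv.
apply: (@le_trans _ _ (lebesgue_measure (I1 `|` I2))).
  by apply: le_measure => //; rewrite inE//; apply: measurableU; case: mI12.
apply: (@le_trans _ _ (lebesgue_measure I1 + lebesgue_measure I2)%E).
  by apply: measureU2; case: mI12.
by rewrite !mI -EFinD lee_fin; lra.
Qed.

(** Eliminates the common target [a]: if two radii both have powers close to it, the radii are
    close, uniformly in [m]. The powers have ratio at most (D+1)/(D-1); since [r ^+ m <= s ^+ m],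
    the same bound holds for s/r. It is at most 3, so (s-r)D <= s+r <= 4r. *)
Lemma pow_near_coincidence (R : realType) (m : nat) (a D r s : R) :
  0 < r -> 2 <= D ->
  `|a - r ^+ m.+1| * D <= r ^+ m.+1 ->
  `|a - s ^+ m.+1| * D <= s ^+ m.+1 ->
  (s - r) * D <= 4 * r.
Proof.
move=> r0 D2 hr hs.
have [sr|/ltW rs] := leP s r; first by nra.
have rm0 : 0 < r ^+ m by rewrite exprn_gt0.
have rsm : r ^+ m <= s ^+ m by rewrite lerXn2r ?nnegrE//; lra.
have BA : (s ^+ m.+1 - r ^+ m.+1) * D <= r ^+ m.+1 + s ^+ m.+1.
  have : s ^+ m.+1 - r ^+ m.+1 <= `|a - r ^+ m.+1| + `|a - s ^+ m.+1|.
    have := ler_norm (a - r ^+ m.+1); have := ler_norm (- (a - s ^+ m.+1)).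
    by rewrite normrN; lra.
  by nra.
move: BA; rewrite !exprS => BA.
have BA' : s * (D - 1) * s ^+ m <= r * (D + 1) * r ^+ m by nra.
have : s * (D - 1) <= r * (D + 1).
  rewrite -(ler_pM2r rm0); apply: le_trans BA'.
  by rewrite ler_wpM2l// mulr_ge0//; lra.
by nra.
Qed.

(** Passes from the modulus to the imaginary part at fixed real part [x]: if |z| >= |y|, then
    (|z|-|y|)^2 <= z^2-y^2 = r(z)^2-r(y)^2. The square root halves the exponent, turning [q ^+ 6]
    into [q ^+ 3]. *)
Lemma abs_near_coincidence (R : realType) (m : nat) (a q x y z K : R) :
  2 <= q ->
  let r t := Num.sqrt (x ^+ 2 + t ^+ 2) in
  0 < r y <= K -> r z <= K ->
  `|a - r y ^+ m.+1| * q ^+ 6 <= r y ^+ m.+1 ->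
  `|a - r z ^+ m.+1| * q ^+ 6 <= r z ^+ m.+1 ->
  `|z| <= `|y| + 3 * K / q ^+ 3.
Proof.
move=> q2 r /andP[ry0 ryK] rzK hy hz.
have [zy|/ltW yz] := leP `|z| `|y|.
  apply: (le_trans zy); rewrite lerDl divr_ge0// ?exprn_ge0//; nra.
have q6 : 2 <= q ^+ 6.
  have : q <= q ^+ 6 by rewrite ler_eXnr//; lra.
  lra.
have zrD := pow_near_coincidence ry0 q6 hy hz.
have rE t : r t ^+ 2 = x ^+ 2 + t ^+ 2 by rewrite sqr_sqrtr// addr_ge0// sqr_ge0.
have rz0 : 0 <= r z by exact: sqrtr_ge0.
have h : (`|z| - `|y|) ^+ 2 <= (r z - r y) * (r z + r y).
  have -> : (r z - r y) * (r z + r y) = r z ^+ 2 - r y ^+ 2 by ring.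
  rewrite !rE -(normr_id y) -(real_normK (num_real z)) -(real_normK (num_real y)) !normr_id.
  have := normr_ge0 y; nra.
rewrite -lerBlDl ler_pdivlMr; last by rewrite exprn_gt0//; lra.
have q3 : 0 <= q ^+ 3 by rewrite exprn_ge0//; lra.
rewrite -(@ler_pXn2r _ 2%N)// ?nnegrE//; [|by rewrite mulr_ge0//; lra|nra].
rewrite exprMn -exprM.
apply: (@le_trans _ _ ((r z - r y) * q ^+ 6 * (r z + r y))).
  by rewrite [leRHS]mulrAC; apply: ler_wpM2r => //; lra.
apply: (@le_trans _ _ (4 * r y * (r z + r y))); first by apply: ler_wpM2r => //; lra.
(* Both radii are at most [K], so the left side is at most 8K^2, below (3K)^2; hence the constant
   3. *)
nra.
Qed.

(** * The exceptional set and its measurability *)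

Definition near_coincidence (R : realType) (n m : nat) : set ((R * R) * (R * R)) :=
  [set p | `|modulus (toC p.1) ^+ n - modulus (toC p.2) ^+ m| * (n + m)%:R ^+ 6
           <= modulus (toC p.2) ^+ m].
Arguments near_coincidence : clear implicits.

(* The indexing is shifted: this is the union over n, m > 0 with n + m = k + 2. *)
Definition near_coincidence_of_weight (R : realType) (k : nat) :=
  \bigcup_(i in `I_k.+1) near_coincidence R i.+1 (k - i).+1.
Arguments near_coincidence_of_weight : clear implicits.

(** Each weight collects finitely many pairs, so lying in infinitely many of these sets means a near
    coincidence for infinitely many (n, m). *)
Definition near_coincidence_io (R : realType) : set ((R * R) * (R * R)) :=
  [set p | 1 < modulus (toC p.2)] `&` lim_sup_set (near_coincidence_of_weight R).
Arguments near_coincidence_io : clear implicits.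

Lemma measurable_modulus (R : realType) :
  measurable_fun setT (fun p : R * R => modulus (toC p)).
Proof.
change (measurable_fun setT ((@Num.sqrt R) \o (fun p : R * R => p.1 ^+ 2 + p.2 ^+ 2))).
apply: measurableT_comp.
  apply: measurable_realfun.continuous_measurable_fun; exact: sqrt_continuous.
apply: measurable_realfun.measurable_funD; apply: measurable_realfun.measurable_funX.
- exact: measurable_fst.
- exact: measurable_snd.
Qed.

Lemma measurable_near_coincidence (R : realType) n m :
  measurable (near_coincidence R n m).
Proof.
have m1 : measurable_fun setT (fun p : (R * R) * (R * R) => modulus (toC p.1)).
  by apply: (measurableT_comp (@measurable_modulus R)); exact: measurable_fst.
have m2 : measurable_fun setT (fun p : (R * R) * (R * R) => modulus (toC p.2)).
  by apply: (measurableT_comp (@measurable_modulus R)); exact: measurable_snd.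
rewrite -[X in measurable X]setTI; apply: measurable_fun_le => //.
- apply: measurable_realfun.measurable_funM => //.
  apply: measurableT_comp => //.
  by apply: measurable_realfun.measurable_funB; exact: measurable_realfun.measurable_funX.
- exact: measurable_realfun.measurable_funX.
Qed.

Lemma measurable_near_coincidence_of_weight (R : realType) k :
  measurable (near_coincidence_of_weight R k).
Proof.
apply: bigcup_measurable => i _; exact: measurable_near_coincidence.
Qed.

Lemma measurable_modulus_gt1 (R : realType) :
  measurable [set p : (R * R) * (R * R) | 1 < modulus (toC p.2)].
Proof.
have m2 : measurable_fun setT (fun p : (R * R) * (R * R) => modulus (toC p.2)).
  by apply: (measurableT_comp (@measurable_modulus R)); exact: measurable_snd.
have := m2 measurableT _ (measurable_itv `]1, +oo[).
by rewrite setTI (_ : _ @^-1` _ = [set p | 1 < modulus (toC p.2)])//; apply/seteqP;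
  split => p /=; rewrite in_itv/= andbT.
Qed.

Lemma measurable_near_coincidence_io (R : realType) :
  measurable (near_coincidence_io R).
Proof.
apply: measurableI; first exact: measurable_modulus_gt1.
apply: bigcap_measurable => // n _; apply: bigcup_measurable => k _.
exact: measurable_near_coincidence_of_weight.
Qed.

(** * Nullity of the exceptional set, through its sections *)

(** Identifies the slice in Im beta, with alpha and Re beta fixed, as an iterated section; this
    yields its measurability and matches the nested product measure. *)
Lemma xsection_xsection (T1 T2 T3 : Type) (A : set (T1 * (T2 * T3))) u x :
  xsection (xsection A u) x = [set y | A (u, (x, y))].
Proof. by apply: eq_set => y; rewrite !xsectionE !inE. Qed.

Lemma lebesgue_near_coincidence_le (R : realType) (alpha : R * R) (x K : R) n m
    (B : set R) :
  0 <= K -> measurable B -> B `<=` [set y | 1 < modulus (toC (x, y)) <= K] ->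
  (lebesgue_measure (B `&` [set y | near_coincidence R n.+1 m.+1 (alpha, (x, y))]) <=
   (12 * K / (n.+1 + m.+1)%:R ^+ 3)%:E)%E.
Proof.
move=> K0 mB BK.
(* Here 3K/w is the spread given by [abs_near_coincidence], and the factor 4 comes from
   [lebesgue_measure_abs_clustered]. *)
have -> w : 12 * K / w = 4 * (3 * K / w) by ring.
apply: lebesgue_measure_abs_clustered.
- by rewrite divr_ge0// mulr_ge0.
- apply: measurableI => //; rewrite -xsection_xsection.
  by do 2 apply: measurable_xsection; exact: measurable_near_coincidence.
- move=> y z [/BK/andP[y1 yK] hy] [/BK/andP[z1 zK] hz].
  apply: (@abs_near_coincidence _ m (modulus (toC alpha) ^+ n.+1) _ x _ _ K) => //.
  + by rewrite ler_nat addnS addSn.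
  + by apply/andP; split => //; exact: lt_trans y1.
Qed.

(** There are k+1 pairs, each contributing at most 12K/(k+2)^3, and (k+1)/(k+2)^3 <= 1/((k+1)(k+2)),
    which is the telescoping difference that [borel_cantelli_telescope] expects. *)
Lemma lebesgue_near_coincidence_of_weight_le (R : realType) (alpha : R * R) (x K : R) k
    (B : set R) :
  0 <= K -> measurable B -> B `<=` [set y | 1 < modulus (toC (x, y)) <= K] ->
  (lebesgue_measure
     (B `&` [set y | near_coincidence_of_weight R k (alpha, (x, y))]) <=
   (12 * K * (k.+1%:R^-1 - k.+2%:R^-1))%:E)%E.
Proof.
move=> K0 mB BK.
pose F i := if (i < k.+1)%N then
  B `&` [set y | near_coincidence R i.+1 (k - i).+1 (alpha, (x, y))] else set0.
have mF i : measurable (F i).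
  rewrite /F; case: ifPn => // _; apply: measurableI => //; rewrite -xsection_xsection.
  by do 2 apply: measurable_xsection; exact: measurable_near_coincidence.
have -> : B `&` [set y | near_coincidence_of_weight R k (alpha, (x, y))] =
    \big[setU/set0]_(i < k.+1) F i.
  rewrite -bigcup_mkord; apply/seteqP; split => y.
    by move=> [By [i /= ik iy]]; exists i => //=; rewrite /F ik; split.
  by move=> [i /= ik]; rewrite /F ik => -[By iy]; split => //; exists i.
apply: (@le_trans _ _ (\sum_(i < k.+1) lebesgue_measure (F i))%E).
  apply: content_subadditive; [by move=> i _; exact: mF|rewrite -bigcup_mkord|exact: subset_refl].
  by apply: bigcup_measurable => i _; exact: mF.
apply: (@le_trans _ _ (\sum_(i < k.+1) (12 * K / k.+2%:R ^+ 3)%:E)%E).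
  apply: lee_sum => i _; rewrite /F ltn_ord.
  rewrite (_ : k.+2 = (i.+1 + (k - i).+1)%N); first exact: lebesgue_near_coincidence_le.
  by have := ltn_ord i; lia.
rewrite sumEFin lee_fin sumr_const card_ord -[leLHS]mulr_natr -!mulrA.
rewrite ler_wpM2l// ler_wpM2l//.
have k1 : 0 < k.+1%:R :> R by [].
have -> : k.+2%:R = k.+1%:R + 1 :> R by rewrite -natr1.
set t := _%:R in k1 *.
have -> : t^-1 - (t + 1)^-1 = (t * (t + 1))^-1 by field; lra.
rewrite ler_pdivrMl; last by apply: exprn_gt0; lra.
rewrite ler_pdivlMr; last by nra.
by nra.
Qed.

(** The measure bounds depend on an upper bound [K] for |beta|, so Borel-Cantelli is applied on each
    region 1 < |beta| <= K, and the resulting null sets are united over all natural [K]. *)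
Lemma lebesgue_near_coincidence_io_section (R : realType) (alpha : R * R) (x : R) :
  lebesgue_measure [set y | near_coincidence_io R (alpha, (x, y))] = 0%E.
Proof.
pose B (K : nat) := [set y | 1 < modulus (toC (x, y)) <= K%:R].
have mB K : measurable (B K).
  have mx : measurable_fun setT (fun y => modulus (toC (x, y))).
    by apply: (measurableT_comp (@measurable_modulus R)); exact: measurable_pair1.
  have := mx measurableT _ (measurable_itv `]1, K%:R]).
  by rewrite setTI (_ : _ @^-1` _ = B K)//; apply/seteqP; split => y /=; rewrite in_itv.
pose F K k := B K `&` [set y | near_coincidence_of_weight R k (alpha, (x, y))].
have mA (A : set ((R * R) * (R * R))) : measurable A -> measurable [set y | A (alpha, (x, y))].
  by move=> ?; rewrite -xsection_xsection; do 2 apply: measurable_xsection.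
have F0 K : lebesgue_measure (lim_sup_set (F K)) = 0%E.
  apply: (@borel_cantelli_telescope _ _ _ _ _ (12 * K%:R)).
  - by rewrite mulr_ge0.
  - move=> k; apply: measurableI; [exact: mB|apply: mA].
    exact: measurable_near_coincidence_of_weight.
  - by move=> k; apply: lebesgue_near_coincidence_of_weight_le.
apply: measure_negligible; first by apply: mA; exact: measurable_near_coincidence_io.
have negF : (@lebesgue_measure R).-negligible (\bigcup_K lim_sup_set (F K)).
  apply: negligible_bigcup => K; apply/negligibleP; last exact: F0.
  apply: bigcap_measurable => // n _; apply: bigcup_measurable => k _.
  apply: measurableI; [exact: mB|apply: mA].
  exact: measurable_near_coincidence_of_weight.
apply: (negligibleS _ negF).
move=> y [/= y1 yio]; exists (Num.truncn (modulus (toC (x, y)))).+1 => // n _.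
have [k nk yk] := yio n I; exists k => //; split=> //; apply/andP; split => //.
by apply/ltW; rewrite -truncn_lt_nat// ltW// (lt_trans _ y1).
Qed.

(** The product measure is by construction an iterated integral of section measures, and the
    innermost measure vanishes identically. *)
Lemma lebesgueC2_near_coincidence_io (R : realType) :
  lebesgueC2 R (near_coincidence_io R) = 0%E.
Proof.
rewrite /lebesgueC2/= /product_measure1/=; apply: integral0_eq => alpha _ /=.
rewrite /lebesgueC/= /product_measure1/=; apply: integral0_eq => x _ /=.
by rewrite xsection_xsection lebesgue_near_coincidence_io_section.
Qed.

(** * Modulus inequalities and counting in boxes *)

Lemma modulusX (R : realType) (z : R[i]) n : modulus (z ^+ n) = modulus z ^+ n.
Proof.
elim: n => [|n IH]; first exact: ComplexField.Normc.normc1.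
by rewrite !exprS -IH; exact: ComplexField.Normc.normcM.
Qed.

Lemma modulus_ge0 (R : realType) (z : R[i]) : 0 <= modulus z.
Proof. by case: z => x y; exact: sqrtr_ge0. Qed.

Lemma modulusB_le (R : realType) (z w : R[i]) :
  modulus (z - w) <= modulus z + modulus w.
Proof.
apply: (le_trans (le_normcD _ _)).
by rewrite normcN.
Qed.

Lemma modulusB_ge (R : realType) (z w : R[i]) :
  `|modulus z - modulus w| <= modulus (z - w).
Proof.
have h (s t : R[i]) : modulus s - modulus t <= modulus (s - t).
  rewrite lerBlDr -{1}(subrK t s).
  exact: le_normcD.
rewrite ler_norml h andbT lerNl opprB; apply: (le_trans (h w z)).
by rewrite -opprB /modulus normcN.
Qed.

Lemma finite_pos_le p : finite_set [set n | (0 < n <= p)%N].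
Proof.
apply: (sub_finite_set _ (finite_II p.+1)) => n /= /andP[_]; by rewrite ltnS.
Qed.

Lemma card_fset_set_le (T : choiceType) (A B : set T) :
  finite_set B -> A `<=` B -> (#|` fset_set A| <= #|` fset_set B|)%N.
Proof.
move=> fB AB; apply: fsubset_leq_card; rewrite -fset_set_sub//.
exact: sub_finite_set fB.
Qed.

Lemma card_box p q :
  #|` fset_set ([set n | (0 < n <= p)%N] `*` [set n | (0 < n <= q)%N])| = (p * q)%N.
Proof.
pose f (x : 'I_p * 'I_q) := ((x.1 : nat).+1, (x.2 : nat).+1).
have -> : [set n | (0 < n <= p)%N] `*` [set n | (0 < n <= q)%N] =
    [set` [fset f x | x in {: 'I_p * 'I_q}]%fset].
  apply/seteqP; split => -[n m] /=.
    case: n m => [|n] [|m] [//=] np mq; apply/imfsetP.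
    by exists (Ordinal np, Ordinal mq).
  by move=> /imfsetP[[i j] _ [-> ->]] /=; rewrite !ltn_ord.
rewrite set_fsetK card_imfset /=; last by move=> [i j] [i' j'] [/val_inj-> /val_inj->].
by rewrite -cardE card_prod !card_ord.
Qed.

(** * Logarithmic estimates *)

Lemma linear_le_ln_bound (R : realType) (l : R) : 0 < l ->
  (* With e = l/28, the inequality ln(e k) < e k gives 14 ln k <= k l/2 - 14 ln e; half of k l is
     absorbed on the left, and [1 <= L] absorbs the constant. *)
  exists2 C, 1 <= C & forall L k : R, 1 <= L -> 0 < k ->
    k * l <= 2 * L + 14 * ln k -> k <= C * L.
Proof.
move=> l0; pose e := l / 28; pose C := (4 + 28 * `|ln e|) / l.
have e0 : 0 < e by rewrite divr_gt0.
exists (C + 1).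
  by rewrite lerDr divr_ge0 ?ltW// addr_ge0// mulr_ge0.
move=> L k L1 k0 h.
have h1 : ln e + ln k < e * k.
  by rewrite -lnM ?posrE//; apply: ln_sublinear; rewrite mulr_gt0.
have ke : 14 * (e * k) = k * l / 2 by rewrite /e; field.
have h2 : - ln e <= `|ln e| by rewrite -normrN ler_norm.
have h3 : k * l <= (4 + 28 * `|ln e|) * L.
  have : `|ln e| <= `|ln e| * L by rewrite ler_peMr.
  nra.
have : k <= C * L by rewrite /C mulrAC ler_pdivlMr.
by nra.
Qed.

(** A bootstrap. Adding the two hypotheses gives k min(u,v) <= 2L + 14 ln k for k = n+m, hence k <=
    C L <= L^2 as soon as L >= C. Then ln k <= 2 ln L, and ln(1 + k^6) <= 7 ln k <= 14 ln L. *)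
Lemma exp_sum_le_log (R : realType) (u v : R) : 0 < u -> 0 < v ->
  exists2 L0, 1 <= L0 & forall (L : R) (n m : nat), L0 <= L ->
    (0 < n)%N -> (0 < m)%N ->
    n%:R * u <= L + ln (1 + (n + m)%:R ^+ 6) ->
    m%:R * v <= L + ln (1 + (n + m)%:R ^+ 6) ->
    n%:R * u <= L + 14 * ln L /\ m%:R * v <= L + 14 * ln L.
Proof.
move=> u0 v0; have l0 : 0 < Num.min u v by rewrite lt_min u0.
have [C C1 HC] := linear_le_ln_bound l0.
exists C => // L n m CL n0 m0 hn hm.
set k : R := (n + m)%:R in hn hm.
have k2 : 2 <= k by rewrite ler_nat; lia.
(* Since k >= 2, 1 + k^6 <= k^7. *)
have lk : ln (1 + k ^+ 6) <= 7 * ln k.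
  rewrite mulr_natl -lnXn; last by lra.
  rewrite ler_ln ?posrE ?exprn_gt0//; [|by rewrite addr_gt0// exprn_gt0; lra|by lra].
  have : 1 <= k ^+ 6 by rewrite exprn_ege1//; lra.
  by rewrite (exprS k 6); nra.
have kCL : k <= C * L.
  apply: HC; [lra|lra|].
  have nl : n%:R * Num.min u v <= n%:R * u by rewrite ler_wpM2l// ge_min lexx.
  have ml : m%:R * Num.min u v <= m%:R * v by rewrite ler_wpM2l// ge_min lexx orbT.
  have -> : k * Num.min u v = n%:R * Num.min u v + m%:R * Num.min u v.
    by rewrite /k natrD mulrDl.
  by lra.
have : ln k <= 2 * ln L.
  rewrite mulr_natl -lnXn; last by lra.
  rewrite ler_ln ?posrE ?exprn_gt0//; [|lra|lra].
  by apply: (le_trans kCL); rewrite expr2 ler_wpM2r//; lra.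
by lra.
Qed.

(** Here [L] stands for ln x, [p] and [q] for the sides of the outer box, [p'] and [q'] for those of
    the inner one, and [N] for the number of extra small pairs. *)
Lemma square_log_bounds (R : realType) (u v : R) (N : nat) : 0 < u -> 0 < v ->
  exists2 M, 0 < M & exists L0, forall (L : R) (T p q p' q' : nat), L0 <= L ->
    (T <= N + p * q)%N -> (p' * q' <= T)%N ->
    p%:R <= (L + 14 * ln L) / u -> q%:R <= (L + 14 * ln L) / v ->
    (L - ln 2) / u <= p'%:R + 1 -> (L - ln 2) / v <= q'%:R + 1 ->
    `|T%:R - L ^+ 2 / (u * v)| <= M * (L * ln L).
Proof.
move=> u0 v0.
pose c := ln 2 / u + 1; pose c' := ln 2 / v + 1.
have ln2 : 0 <= ln 2 :> R by rewrite ln_ge0// ler1n.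
have c0 : 0 < c by rewrite ltr_pwDr// divr_ge0// ltW.
have c'0 : 0 < c' by rewrite ltr_pwDr// divr_ge0// ltW.
have u'0 : 0 < u^-1 by rewrite invr_gt0.
have v'0 : 0 < v^-1 by rewrite invr_gt0.
(* Expanding (L + 14 ln L)^2 leaves 28 L ln L + 196 (ln L)^2, at most 224 L ln L. The terms in [c]
   and [c'] are the linear loss of the lower bound. *)
exists (N%:R + 224 / (u * v) + (c' / u + c / v) + 1).
  rewrite ltr_pwDr// !addr_ge0// ?ltW// ?divr_gt0// mulr_gt0//.
(* This threshold gives ln L >= 1 and makes L/u - c and L/v - c' nonnegative, so the two lower
   bounds can be multiplied. *)
exists (expR 1 + u * c + v * c') => L T p q p' q' L0 Tub Tlb hp hq hp' hq'.
have uc : 0 < u * c by rewrite mulr_gt0.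
have vc : 0 < v * c' by rewrite mulr_gt0.
have e1 : 1 < expR 1 :> R by rewrite expR_gt1.
have L1 : 1 <= L by lra.
have LL1 : 1 <= ln L.
  by rewrite -(expRK 1) ler_ln ?posrE ?expR_gt0//; lra.
have LLL : ln L <= L by apply/ltW/ln_sublinear; lra.
have L_LL : L <= L * ln L by rewrite ler_peMr//; lra.
have TubR : T%:R <= N%:R + p%:R * q%:R :> R by rewrite -natrM -natrD ler_nat.
have TlbR : p'%:R * q'%:R <= T%:R :> R by rewrite -natrM ler_nat.
have mainE : L ^+ 2 / (u * v) = (L / u) * (L / v) by field; lra.
rewrite ler_norml; apply/andP; split.
  have p'l : L / u - c <= p'%:R by rewrite /c; lra.
  have q'l : L / v - c' <= q'%:R by rewrite /c'; lra.
  have p'0 : 0 <= L / u - c by rewrite subr_ge0 ler_pdivlMr// mulrC; lra.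
  have q'0 : 0 <= L / v - c' by rewrite subr_ge0 ler_pdivlMr// mulrC; lra.
  have pq : (L / u - c) * (L / v - c') <= p'%:R * q'%:R by exact: ler_pM.
  have cc : (c' / u + c / v) * L <= (c' / u + c / v) * (L * ln L).
    by rewrite ler_wpM2l// addr_ge0// ltW// mulr_gt0.
  have -> : L ^+ 2 / (u * v) = (L / u - c) * (L / v - c') + (c' / u + c / v) * L - c * c'.
    by field; lra.
  have : 0 <= (N%:R + 224 / (u * v) + 1) * (L * ln L).
    rewrite !mulr_ge0 ?addr_ge0//; [|lra|lra].
    by rewrite ltW// divr_gt0// mulr_gt0.
  have : 0 < c * c' by rewrite mulr_gt0.
  by lra.
have pq : p%:R * q%:R <= (L + 14 * ln L) / u * ((L + 14 * ln L) / v) by exact: ler_pM.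
have pqE : (L + 14 * ln L) / u * ((L + 14 * ln L) / v) - L ^+ 2 / (u * v) =
    (28 * (L * ln L) + 196 * (ln L * ln L)) / (u * v) by field; lra.
have : (28 * (L * ln L) + 196 * (ln L * ln L)) / (u * v) <= 224 / (u * v) * (L * ln L).
  rewrite mulrAC ler_wpM2r//; first by rewrite invr_ge0 ltW// mulr_gt0.
  by nra.
have : N%:R <= N%:R * (L * ln L) :> R by rewrite ler_peMr//; nra.
have : 0 <= (c' / u + c / v) * (L * ln L).
  by rewrite mulr_ge0//; [rewrite addr_ge0// ltW// mulr_gt0|nra].
have : 0 <= L * ln L by nra.
by lra.
Qed.

(** * Enclosing [Tset] between boxes and counting *)

Local Notation posbox p q :=
  ([set n | (0 < n <= p)%N] `*` [set n | (0 < n <= q)%N]).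

Lemma eventually_far (R : realType) (p : (R * R) * (R * R)) :
  1 < modulus (toC p.2) -> ~ near_coincidence_io R p ->
  exists N, forall n m, (0 < n)%N -> (0 < m)%N -> (N <= n + m)%N ->
    let d := modulus (toC p.1 ^+ n - toC p.2 ^+ m) in
    modulus (toC p.1) ^+ n <= d * (1 + (n + m)%:R ^+ 6) /\
    modulus (toC p.2) ^+ m <= d * (1 + (n + m)%:R ^+ 6).
Proof.
move=> b1 /not_andP[//|/existsNP[N /not_implyP[_ hN]]].
(* The shift by 2 matches the indexing: weight index [k] means exponents with sum k+2. *)
exists N.+2 => -[|n] [|m]// _ _ Nnm d.
have /negP : ~ near_coincidence R n.+1 m.+1 p.
  move=> nc; apply: hN; exists (n + m)%N => /=; first by lia.
  by exists n => /=; [lia|rewrite addKn].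
rewrite -ltNge; set a := modulus (toC p.1) ^+ _; set b := modulus (toC p.2) ^+ _.
set w := _ ^+ 6 => far.
have w0 : 0 <= w by rewrite exprn_ge0.
have abd : `|a - b| <= d.
  (* Being far gives b < |a-b| w <= d w; adding |a-b| <= d then bounds a by d(1+w). *)
  by rewrite /a /b -!modulusX; exact: modulusB_ge.
have abd' : `|a - b| * w <= d * w by rewrite ler_wpM2r.
have ab := ler_norm (a - b); have d0 := modulus_ge0 (toC p.1 ^+ n.+1 - toC p.2 ^+ m.+1).
by rewrite -/d in d0; split; rewrite mulrDr mulr1; lra.
Qed.

(** The square box holds the finitely many pairs before [eventually_far] applies; the other pairs
    satisfy the bounds of [exp_sum_le_log]. Nonnegativity of [E] is recorded because [Num.truncn] is
    0 on negative reals and bounds its argument from below only on nonnegative ones. *)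
Lemma Tset_sub_box (R : realType) (p : (R * R) * (R * R)) :
  1 < modulus (toC p.1) -> 1 < modulus (toC p.2) -> ~ near_coincidence_io R p ->
  let u := ln (modulus (toC p.1)) in let v := ln (modulus (toC p.2)) in
  exists N L0, forall x : R, 0 < x -> L0 <= ln x ->
  let E := ln x + 14 * ln (ln x) in
    0 <= E /\
    Tset (toC p.1) (toC p.2) x `<=`
      posbox N N `|` posbox (Num.truncn (E / u)) (Num.truncn (E / v)).
Proof.
move=> a1 b1 pio u v.
have u0 : 0 < u by rewrite ln_gt0.
have v0 : 0 < v by rewrite ln_gt0.
have [N hN] := eventually_far b1 pio.
have [L0 L01 hL0] := exp_sum_le_log u0 v0.
exists N, L0 => x x0 L0x E.
have lx1 : 1 <= ln x by lra.
have E0 : 0 <= E by have := ln_ge0 lx1; rewrite /E; lra.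
split=> // -[n m] [/= n0 m0 dx].
have [nmN|Nnm] := ltnP (n + m) N; first by left; split=> /=; lia.
right.
have w0 : 0 < 1 + (n + m)%:R ^+ 6 :> R by rewrite ltr_pwDl// exprn_ge0.
have ln_bound (c : R) k : 1 < c ->
    c ^+ k <= modulus (toC p.1 ^+ n - toC p.2 ^+ m) * (1 + (n + m)%:R ^+ 6) ->
    k%:R * ln c <= ln x + ln (1 + (n + m)%:R ^+ 6).
  move=> c1 h; have c0 : 0 < c by lra.
  rewrite mulr_natl -lnXn// -lnM ?posrE// ler_ln ?posrE ?exprn_gt0 ?mulr_gt0//.
  by apply: (le_trans h); rewrite ler_wpM2r// ltW.
have [ha hb] := hN _ _ n0 m0 Nnm.
have [nE mE] := hL0 _ _ _ L0x n0 m0 (ln_bound _ _ a1 ha) (ln_bound _ _ b1 hb).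
by split; rewrite /= (n0, m0)/= truncn_ge_nat ?divr_ge0 ?(ltW u0) ?(ltW v0)// ler_pdivlMr.
Qed.

Lemma box_sub_Tset (R : realType) (alpha beta : R[i]) (x : R) :
  1 < modulus alpha -> 1 < modulus beta -> 0 < x ->
  posbox (Num.truncn ((ln x - ln 2) / ln (modulus alpha)))
         (Num.truncn ((ln x - ln 2) / ln (modulus beta))) `<=`
  Tset alpha beta x.
Proof.
move=> a1 b1 x0.
have half (c : R) k : 1 < c -> (0 < k <= Num.truncn ((ln x - ln 2) / ln c))%N ->
    c ^+ k <= x / 2.
  move=> c1 /andP[k0 kt]; have lc0 : 0 < ln c by rewrite ln_gt0.
  have : k%:R <= (ln x - ln 2) / ln c.
    apply: le_trans (_ : (Num.truncn ((ln x - ln 2) / ln c))%:R <= _).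
      by rewrite ler_nat.
    (* A positive [k] forces a positive truncation, hence a nonnegative quotient, as [truncn_le]
       requires. *)
    rewrite truncn_le.
    have : (0 < Num.truncn ((ln x - ln 2) / ln c))%N by exact: leq_trans kt.
    by rewrite truncn_gt0; lra.
  rewrite ler_pdivlMr// mulr_natl -lnXn; last by lra.
  by rewrite -ln_div ?posrE// ler_ln ?posrE ?exprn_gt0 ?divr_gt0//; lra.
move=> [n m] [/= hn hm]; split; [by case/andP: hn|by case/andP: hm|].
apply: (le_trans (modulusB_le _ _)); rewrite !modulusX/=.
have := half _ _ a1 hn; have := half _ _ b1 hm; lra.
Qed.

Lemma Tset_asymptotics (R : realType) (p : (R * R) * (R * R)) :
  let alpha := toC p.1 in let beta := toC p.2 in
  1 < modulus alpha -> 1 < modulus beta -> ~ near_coincidence_io R p ->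
  (forall x : R, finite_set (Tset alpha beta x)) /\
  (fun x : R => (Tcard alpha beta x)%:R) =
    (fun x : R => ln x ^+ 2 / (ln (modulus alpha) * ln (modulus beta)))
    +O_ (+oo_R) (fun x : R => ln x * ln (ln x)).
Proof.
move=> alpha beta a1 b1 pio.
set u := ln (modulus alpha); set v := ln (modulus beta).
have u0 : 0 < u by rewrite ln_gt0.
have v0 : 0 < v by rewrite ln_gt0.
have [N [L1 ub]] := Tset_sub_box a1 b1 pio.
have finbox r q : finite_set (posbox r q).
  by apply: finite_setX; exact: finite_pos_le.
split.
  (* [Tset] grows with its bound, so finiteness at a large enough [y] gives it at every [x]. *)
  move=> x; pose y := Num.max x (expR L1).
  have y0 : 0 < y by rewrite lt_max expR_gt0 orbT.
  have L1y : L1 <= ln y by rewrite -{1}(expRK L1) ler_ln ?posrE ?expR_gt0// le_max lexx orbT.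
  have [_ sub] := ub y y0 L1y.
  apply: (@sub_finite_set _ _ (Tset alpha beta y)).
    by move=> z [z1 z2 zx]; split=> //; rewrite le_max zx.
  apply: (sub_finite_set sub); rewrite finite_setU; split; exact: finbox.
(* N * N is the size of the square box of small pairs. *)
have [M M0 [L2 bound]] := square_log_bounds (N * N)%N u0 v0.
apply/eqaddOP/bigO_exP; exists M => //.
(* The 1 in the maximum gives ln x >= 1, so ln(ln x) >= 0 and the error term equals its absolute
   value. *)
have : \forall x \near +oo, expR (Num.max (Num.max L1 L2) 1) < x.
  exact: nbhs_pinfty_gt.
apply: filterS => x xL.
have x0 : 0 < x by apply: lt_trans xL; exact: expR_gt0.
have : Num.max (Num.max L1 L2) 1 <= ln x.
  by rewrite -{1}(expRK (Num.max _ _)) ler_ln ?posrE ?expR_gt0// ltW.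
rewrite !ge_max -andbA => /and3P[L1x L2x lx1].
have [E0 sub] := ub x x0 L1x.
have lE (w : R) : 0 < w -> (ln x - ln 2) / w <= (Num.truncn ((ln x - ln 2) / w))%:R + 1.
  (* For a negative quotient the truncation defaults to 0 and the bound is trivial. *)
  move=> w0; have [t0|/ltW t0] := leP 0 ((ln x - ln 2) / w).
    by have /andP[_ /ltW] := truncn_itv t0; rewrite natr1.
  by apply: (le_trans t0); rewrite addr_ge0.
rewrite !fctE [X in _ <= _ * X]ger0_norm; last first.
  by rewrite mulr_ge0 ?(ln_ge0 lx1)//; lra.
pose E := ln x + 14 * ln (ln x).
apply: (bound _ _ (Num.truncn (E / u)) (Num.truncn (E / v)) _ _
  L2x _ _ _ _ (lE u u0) (lE v v0)).
- rewrite -!card_box; apply: (leq_trans (card_fset_set_le _ sub)).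
    by rewrite finite_setU; split; exact: finbox.
  by rewrite fset_setU; [rewrite cardfsU leq_subr|exact: finbox|exact: finbox].
- rewrite -card_box; apply: card_fset_set_le; last exact: box_sub_Tset.
  apply: (sub_finite_set sub); rewrite finite_setU; split; exact: finbox.
- by rewrite truncn_le divr_ge0// ltW.
- by rewrite truncn_le divr_ge0// ltW.
Qed.

Theorem corollary1 (R : realType) :
  {ae lebesgueC2 R, forall p : (R * R) * (R * R),
    let alpha := toC p.1 in
    let beta := toC p.2 in
    1 < modulus alpha -> 1 < modulus beta ->
    (forall x : R, finite_set (Tset alpha beta x)) /\
    (fun x : R => (Tcard alpha beta x)%:R) =
      (fun x : R => ln x ^+ 2 / (ln (modulus alpha) * ln (modulus beta)))
      +O_ (+oo_R) (fun x : R => ln x * ln (ln x)) }.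
Proof.
exists (near_coincidence_io R); split.
- exact: measurable_near_coincidence_io.
- exact: lebesgueC2_near_coincidence_io.
- move=> p; apply: contra_notP => pio a1 b1.
  exact: (Tset_asymptotics a1 b1 pio).
Qed.
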